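(* Let $d\geq 1$ be an integer. If $Q$ is a finite (left) quasifield with $q$ elements and $A\subset Q$ with $|A| > q^{\frac{d+2}{2d+2}}$, then \[ Q = A + A + \underbrace{A\cdot A + \cdots + A\cdot A}_{d\ \text{terms}}, \] i.e., every element of $Q$ can be written as $a + a' + a_1\cdot a_1' + \cdots + a_d\cdot a_d'$ with all $a,a',a_i,a_i'\in A$.
   Context: A (left) quasifield is a set $Q$ with two binary operations $+$ and $\cdot$ such that $(Q,+)$ is a group with identity $0$; $(Q\setminus\{0\},\cdot)$ is a loop (for all $a,b$ the equations $a\cdot x=b$ and $y\cdot a=b$ have unique solutions, and there is an identity $1$); $a\cdot(b+c)=a\cdot b+a\cdot c$ for all $a,b,c$; $0\cdot x=0$ for all $x$; and for $a\neq b$ the equation $a\cdot x=b\cdot x+c$ has exactly one solution $x$. ($(Q,+)$ is then abelian.) *)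

(* Defs.v *)
From mathcomp Require Import all_boot.

Set Implicit Arguments.
Unset Strict Implicit.
Unset Printing Implicit Defensive.

(* The additive group of a quasifield is not assumed abelian, so the library's
   [zmodType] is not used for it. *)
Record is_group (Q : Type) (e : Q) (op : Q -> Q -> Q) : Prop := IsGroup {
  group_assoc : associative op;
  group_idl : left_id e op;
  group_idr : right_id e op;
  group_inv : forall x, exists y, op y x = e /\ op x y = e
}.

Record is_loop_on (Q : Type) (S : pred Q) (op : Q -> Q -> Q) : Prop := IsLoopOn {
  loop_closed : forall a b, S a -> S b -> S (op a b);
  loop_divl : forall a b, S a -> S b -> exists! x, S x /\ op a x = b;
  loop_divr : forall a b, S a -> S b -> exists! y, S y /\ op y a = b;
  loop_id : exists e, S e /\ (forall a, S a -> op e a = a /\ op a e = a)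
}.

Record is_quasifield (Q : eqType) (zero : Q) (add mul : Q -> Q -> Q) : Prop :=
  IsQuasifield {
    qf_add_group : is_group zero add;
    qf_mul_loop : is_loop_on (fun x => x != zero) mul;
    qf_distr : right_distributive mul add;
    qf_mul0 : left_zero zero mul;
    qf_planar : forall a b c, a <> b ->
      exists! x, mul a x = add (mul b x) c
  }.

Definition setop (Q : finType) (op : Q -> Q -> Q) (A B : {set Q}) : {set Q} :=
  [set op a b | a in A, b in B].

(* The term {zero} is neutral for set addition; it is the value for d = 0. *)
Definition sum_of_products (Q : finType) (zero : Q) (add mul : Q -> Q -> Q)
    (d : nat) (A : {set Q}) : {set Q} :=
  \big[setop add/[set zero]]_(i < d) setop mul A A.

(* Main.v *)
Require Import Defs.
From HB Require Import structures.
From mathcomp Require Import all_boot all_order all_algebra.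
From mathcomp Require Import all_fingroup all_solvable.
From mathcomp Require Import zify ring.
From mathcomp Require Import reals exp.
Import Order.TTheory GRing.Theory Num.Theory.

(** Fix a target [t] and consider the bipartite graph on two copies of
    [Q^d * Q] joining [(x, a)] to [(z, w)] when
    [a + w + x_1 z_1 + ... + x_d z_d = t]. All degrees are [q^d], and planarity
    bounds every codegree by [q^(d-1)], so the number of neighbours in
    [S = A^d * A] of a vertex has second moment close to the square of its mean.
    If [t] were not represented, the [|A|^(d+1)] vertices of [A^d * A] on the
    other side would have no neighbour in [S], and the variance would force
    [|A|^(2d+2) <= q^(d+2)].

    Addition is commutative because left multiplications are automorphisms
    of [(Q, +)] moving any nonzero element to any other: all nonzero elements
    then have the same prime order, so [(Q, +)] is a [p]-group, and its
    nontrivial centre is everything. *)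

Lemma transitive_automorphisms_abelian (gT : finGroupType) :
  (forall x y : gT, x != 1%g -> y != 1%g ->
     exists f : gT -> gT,
       [/\ {morph f : u v / (u * v)%g}, injective f & f x = y]) ->
  commutative (@mulg gT).
Proof.
move=> trans x y.
have [->|x1] := eqVneq x 1%g; first by rewrite mul1g mulg1.
have f1 (f : gT -> gT) : {morph f : u v / (u * v)%g} -> f 1%g = 1%g.
  by move=> fM; apply: (mulgI (f 1%g)); rewrite -fM !mulg1.
have G_gt1 : 1 < #|[set: gT]|.
  by rewrite (cardD1 x) (cardD1 1%g) !inE eq_sym x1.
set p := pdiv #|[set: gT]|.
have p_pr : prime p by apply: pdiv_prime.
(* A morphism [f] sending [u] to an element [v] of order [p] gives [v ^+ r = f (u ^+ r) = 1], so [p]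
   divides the prime [r]. *)
have ord r (u : gT) : prime r -> #[u]%g = r -> r = p.
  move=> r_pr ur.
  have [v _ vp] := Cauchy p_pr (pdiv_dvd #|[set: gT]|).
  have u1 : u != 1%g by rewrite -order_gt1 ur prime_gt1.
  have v1 : v != 1%g by rewrite -order_gt1 vp prime_gt1.
  have [f [fM fI fuv]] := trans u v u1 v1.
  have fX n : f (u ^+ n)%g = (v ^+ n)%g.
    by elim: n => [|n IH]; rewrite ?expg0 ?f1 // !expgS fM IH fuv.
  apply/eqP; rewrite eq_sym -dvdn_prime2 //.
  by rewrite -vp order_dvdn -fX -ur expg_order f1.
have pG : (p.-group [set: gT])%g.
  apply/pnatP => // r r_pr rG.
  by have [u _ ur] := Cauchy r_pr rG; rewrite inE (ord r u).
have /trivgPn[z Zz z1] : 'Z([set: gT])%g != 1%g.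
  apply/eqP => /(trivg_center_pgroup pG) G1.
  move: (in_setT x); rewrite G1 => /set1gP x_eq1.
  by rewrite x_eq1 eqxx in x1.
(* By finiteness [f] is onto, so it carries the central element [z] to a central one, namely [x]. *)
have [f [fM fI fzx]] := trans z x z1 x1.
have [g fK gK] := injF_bij fI.
rewrite -(gK y) -fzx -!fM; congr f.
by case/centerP: Zz => _; apply; rewrite inE.
Qed.

(* Every vertex of [T] deviates from the mean number of neighbours in [S] by the
   full mean, while the hypotheses bound the total variance. *)
Lemma no_edges_card_bound (X Y : finType) (e : X -> Y -> bool) (k c : nat)
    (S : {set X}) (T : {set Y}) :
  (forall x, x \in S -> #|[set y | e x y]| = k) ->
  (forall x x', x \in S -> x' \in S -> x != x' ->
     #|[set y | e x y && e x' y]| <= c) ->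
  c * #|Y| <= k ^ 2 ->
  (forall x y, x \in S -> y \in T -> ~~ e x y) ->
  #|S| * #|T| * k <= #|Y| ^ 2.
Proof.
move=> degS codegS ck noE.
have [->|s_gt0] := posnP #|S|; first by rewrite !mul0n.
have [->|k_gt0] := posnP k; first by rewrite muln0.
pose N y := \sum_(x in S) e x y.
have sumN : \sum_y N y = #|S| * k.
  rewrite exchange_big /= -sum_nat_const; apply: eq_bigr => x Sx.
  rewrite -(degS x Sx) -sum1dep_card [RHS]big_mkcond.
  by apply: eq_bigr => y _; case: (e x y).
(* The second moment sums codegrees over pairs in [S]: each diagonal pair gives [k], and the fewer
   than [#|S| ^ 2] others give at most [c]. *)
have sumN2 : \sum_y N y ^ 2 <= #|S| * k + #|S| ^ 2 * c.
  have -> : \sum_y N y ^ 2 = \sum_(x in S) \sum_(x' in S) \sum_y e x y * e x' y.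
    under eq_bigr => y _ do rewrite expnS expn1 /N big_distrlr /=.
    by rewrite exchange_big; apply: eq_bigr => x _; rewrite exchange_big.
  have -> : #|S| * k + #|S| ^ 2 * c = \sum_(x in S) (k + #|S| * c).
    by rewrite sum_nat_const mulnDr expnS expn1 mulnA.
  apply: leq_sum => x Sx; rewrite (bigD1 x) //=; apply: leq_add.
    rewrite -(degS x Sx) -sum1dep_card [leqRHS]big_mkcond; apply: leq_sum => y _.
    by case: (e x y).
  apply: (@leq_trans (\sum_(x' in S | x' != x) c)); last first.
    rewrite sum_nat_const leq_mul2r subset_leq_card ?orbT //.
    by apply/subsetP => ? /andP[].
  apply: leq_sum => x' /andP[Sx' x'x].
  apply: leq_trans (codegS x x' Sx Sx' _); last by rewrite eq_sym.
  rewrite -sum1dep_card [leqRHS]big_mkcond; apply: leq_sum => y _.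
  by case: (e x y); case: (e x' y).
have NT y : y \in T -> N y = 0.
  by move=> Ty; apply: big1 => x Sx; rewrite (negbTE (noE x y Sx Ty)).
(* Deviations are scaled by [#|Y|] to avoid dividing by it, and live in [int] because they can be
   negative. Only the terms of [T] are kept. *)
have var : (#|T|%:R * (#|S| * k)%:R ^+ 2 <=
    \sum_y (#|Y|%:R * (N y)%:R - (#|S| * k)%:R) ^+ 2 :> int)%R.
  rewrite mulr_natl -sumr_const [leRHS](bigID (mem T)) /= -[leLHS]addr0.
  apply: lerD; last by apply: sumr_ge0 => y _; apply: sqr_ge0.
  by apply: ler_sum => y Ty; rewrite NT // mulr0 sub0r sqrrN.
have varE : (\sum_y (#|Y|%:R * (N y)%:R - (#|S| * k)%:R) ^+ 2 =
    #|Y|%:R ^+ 2 * (\sum_y N y ^ 2)%:R - #|Y|%:R * (#|S| * k)%:R ^+ 2 :> int)%R.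
  rewrite (eq_bigr (fun y => #|Y|%:R ^+ 2 * (N y ^ 2)%:R +
      (- (2 * #|Y|%:R * (#|S| * k)%:R) * (N y)%:R + (#|S| * k)%:R ^+ 2)))%R; last first.
    by move=> y _; rewrite natrX; ring.
  rewrite !big_split /= -!mulr_sumr -!natr_sum sumN sumr_const -[X in (_ *+ X)%R]/#|Y|.
  by rewrite -[(_ *+ #|Y|)%R]mulr_natl; ring.
(* By [ck] the off-diagonal pairs are absorbed by the squared mean; only the diagonal contribution
   survives on the right. *)
have {var varE} : #|T| * (#|S| * k) ^ 2 <= #|Y| ^ 2 * (#|S| * k).
  have : #|T| * (#|S| * k) ^ 2 + #|Y| * (#|S| * k) ^ 2 <= #|Y| ^ 2 * \sum_y N y ^ 2.
    by move: var; rewrite varE lerBrDr -!natrX -!natrM -natrD ler_nat.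
  have : #|Y| * #|S| ^ 2 * (c * #|Y|) <= #|Y| * #|S| ^ 2 * k ^ 2.
    by rewrite leq_mul2l ck orbT.
  have : #|Y| ^ 2 * \sum_y N y ^ 2 <= #|Y| ^ 2 * (#|S| * k + #|S| ^ 2 * c).
    by rewrite leq_mul2l sumN2 orbT.
  move: (\sum_y _) => M; nia.
have : 0 < #|S| * k by rewrite muln_gt0 s_gt0.
by move=> sk_gt0; rewrite expnS expn1 mulnA leq_pmul2r // mulnA [#|T| * _]mulnC.
Qed.

Lemma planar_sum_of_products (V : finZmodType) (mul : V -> V -> V) (d : nat)
    (A : {set V}) (t : V) :
  (forall a b x y c, a != b -> mul a x = (mul b x + c)%R ->
     mul a y = (mul b y + c)%R -> x = y) ->
  (0 < d)%N ->
  #|V| ^ d.+2 < #|A| ^ (d.+1).*2 ->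
  exists (u v : V) (f g : {ffun 'I_d -> V}),
    [/\ u \in A, v \in A, forall i, f i \in A, forall i, g i \in A &
        t = (u + v + \sum_i mul (f i) (g i))%R].
Proof.
move=> planar d_gt0 cardA.
pose X := ({ffun 'I_d -> V} * V)%type.
pose e (p r : X) := (p.2 + r.2 + \sum_i mul (p.1 i) (r.1 i) == t)%R.
pose S : {set X} := [set p | (p.1 \in ffun_on A) && (p.2 \in A)].
have eE p r : e p r -> r.2 = (t - p.2 - \sum_i mul (p.1 i) (r.1 i))%R.
  by move=> /eqP <-; rewrite addrAC addrK addrC addKr.
have cardS : #|S| = #|A| ^ d.+1.
  have -> : S = setX [set f in ffun_on A] A by apply/setP=> -[f a]; rewrite !inE.
  by rewrite cardsX cardsE card_ffun_on card_ord expnSr.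
have cardX : #|{: X}| = #|V| ^ d.+1 by rewrite card_prod card_ffun card_ord expnSr.
have deg p : #|[set r | e p r]| = #|V| ^ d.
  pose h (z : {ffun 'I_d -> V}) : X := (z, (t - p.2 - \sum_i mul (p.1 i) (z i))%R).
  have -> : [set r | e p r] = [set h z | z in [set: {ffun 'I_d -> V}]].
    apply/setP=> -[z w]; rewrite inE; apply/idP/imsetP => [/eE /= ->|[z' _ [-> ->]]].
      by exists z; rewrite ?inE.
    by apply/eqP; rewrite /= addrA subrK addrC subrK.
  by rewrite card_imset ?cardsT ?card_ffun ?card_ord // => z z' [].
have codeg p p' : p != p' -> #|[set r | e p r && e p' r]| <= #|V| ^ d.-1.
  case: p p' => [x a] [x' a'] pp'.
  have [xx'|] := eqVneq x x'.
    rewrite (_ : [set _ | _] = set0) ?cards0 //; apply/setP => r; rewrite !inE.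
    apply/negP => /andP[/eqP E /eqP E'].
    have aa' : a = a'.
      apply: (addIr (r.2 + \sum_i mul (x i) (r.1 i))%R).
      by rewrite !addrA {2}xx' E E'.
    by rewrite xx' aa' eqxx in pp'.
  move=> /eqP xx'.
  have [i xi] : exists i, x i != x' i.
    apply/existsP; apply: contraT; rewrite negb_exists => /forallP H.
    by case: xx'; apply/ffunP => i; apply/eqP; rewrite -[_ == _]negbK.
  (* A common neighbour is determined by its coordinates other than [i]: planarity recovers
     coordinate [i], then either edge recovers [w]. The filler 0 puts the image of [h] among the
     [#|V| ^ d.-1] functions supported off [i]. *)
  pose h (r : X) : {ffun 'I_d -> V} := [ffun j => if j == i then 0%R else r.1 j].
  have hI : {in [set r | e (x, a) r && e (x', a') r] &, injective h}.
    move=> [z w] [z' w']; rewrite !inE => /andP[E1 E2] /andP[E1' E2'] /ffunP hh.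
    have zz' j : j != i -> z j = z' j.
      by move=> ji; have := hh j; rewrite !ffunE (negbTE ji).
    pose c (y : {ffun 'I_d -> V}) := (\sum_(j | j != i) mul (y j) (z j))%R.
    have cE (y : {ffun 'I_d -> V}) :
        (\sum_j mul (y j) (z j))%R = (mul (y i) (z i) + c y)%R.
      by rewrite (bigD1 i).
    have cE' (y : {ffun 'I_d -> V}) :
        (\sum_j mul (y j) (z' j))%R = (mul (y i) (z' i) + c y)%R.
      by rewrite (bigD1 i) //; congr +%R; apply: eq_bigr => j ji; rewrite zz'.
    (* Eliminating [w] between the two edge equations leaves an equation of the planar form in
       coordinate [i]. *)
    have cancel_w (u m m' s s' : V) : (a + u + (m + s) == t)%R ->
        (a' + u + (m' + s') == t)%R -> m = (m' + (a' + s' - (a + s)))%R.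
      move=> /eqP <-; rewrite !(addrAC _ u) (inj_eq (addIr u)) => /eqP E.
      by apply/eqP; rewrite addrA eq_sym subr_eq addrCA E addrCA.
    have zi : z i = z' i.
      apply: (planar _ _ _ _ (a' + c x' - (a + c x))%R xi).
      - by move: E1 E2; rewrite /e /= !cE; apply: cancel_w.
      - by move: E1' E2'; rewrite /e /= !cE'; apply: cancel_w.
    have zz : z = z'.
      by apply/ffunP => j; have [->|/zz'] := eqVneq j i.
    by move: (eE _ _ E1) (eE _ _ E1') => /= -> ->; rewrite zz.
  rewrite -(card_in_imset hI).
  apply: (@leq_trans #|pffun_on (0%R : V) (predC1 i) predT|); last first.
    by rewrite card_pffun_on cardC1 card_ord cardT -cardE.
  apply/subset_leq_card/subsetP => f /imsetP[r _ ->].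
  apply/pffun_onP; split=> [|j _] //; apply/supportP => j.
  by rewrite inE negbK /h ffunE => ->.
have [/existsP[p /andP[pS /existsP[r /andP[rS /eqP E]]]]|noE] :=
    boolP [exists p in S, exists r in S, e p r].
  move: pS rS; rewrite !inE => /andP[/ffun_onP p1 p2] /andP[/ffun_onP r1 r2].
  by exists p.2, r.2, p.1, r.1; split.
have := @no_edges_card_bound _ _ e (#|V| ^ d) (#|V| ^ d.-1) S S.
rewrite cardS cardX.
have ck : #|V| ^ d.-1 * #|V| ^ d.+1 <= (#|V| ^ d) ^ 2.
  rewrite -expnD -expnM; case: (d) d_gt0 => // n _.
  by rewrite (_ : _ + _ = n.+1 * 2) //; lia.
have noE' p r : p \in S -> r \in S -> ~~ e p r.
  move=> pS rS; apply: contra noE => per.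
  by apply/existsP; exists p; rewrite pS; apply/existsP; exists r; rewrite rS.
move=> /(_ (fun p _ => deg p) (fun p p' _ _ => @codeg p p') ck noE').
have V_gt0 : 0 < #|V| by apply/card_gt0P; exists t.
(* Splitting off the degree [#|V| ^ d] lets it cancel, leaving the negation of [cardA]. *)
have -> : (#|V| ^ d.+1) ^ 2 = #|V| ^ d.+2 * #|V| ^ d.
  by rewrite -expnM -expnD; congr expn; lia.
by rewrite leq_pmul2r ?expn_gt0 ?V_gt0 // -expnD addnn leqNgt cardA.
Qed.

(** If [mul a x = mul a y], then [x] and [y] both solve the planar equation with slopes [a] and
    [zero] and constant [mul a y]. *)
Lemma quasifield_left_mul_inj (Q : eqType) (zero : Q) (add mul : Q -> Q -> Q) a :
  is_quasifield zero add mul -> a != zero -> injective (mul a).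
Proof.
move=> [[_ add0 _ _] _ _ mul0 planar] /eqP a0 x y axy.
have [z [_ zU]] := planar a zero (mul a y) a0.
by rewrite -(zU x) ?(zU y) // mul0 add0.
Qed.

Lemma group_inverse (Q : choiceType) (zero : Q) (add : Q -> Q -> Q) :
  is_group zero add ->
  exists inv, left_inverse zero inv add /\ right_inverse zero inv add.
Proof.
move=> [_ _ _ addI].
have inv x : exists y, (add y x == zero) && (add x y == zero).
  by have [y [yx xy]] := addI x; exists y; rewrite yx xy eqxx.
by exists (fun x => xchoose (inv x)); split=> x;
  have /andP[/eqP ? /eqP ?] := xchooseP (inv x).
Qed.

(** Right division in the loop provides [a] with [mul a x = y], and distributivity makes [mul a]
    additive. *)
Lemma quasifield_addC (Q : finType) (zero : Q) (add mul : Q -> Q -> Q) :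
  is_quasifield zero add mul -> commutative add.
Proof.
move=> qfQ; have [gQ [_ _ divr _] mulD _ _] := qfQ; have [addA add0 addr0 _] := gQ.
have [inv [addN addrN]] := group_inverse _ _ _ gQ.
pose G : finGroupType := HB.pack Q (isGroup.Build Q addA add0 addr0 addN addrN).
apply: (@transitive_automorphisms_abelian G) => x y x0 y0.
have [a [[a0 axy] _]] := divr x y x0 y0.
exists (mul a); split=> //.
exact: (quasifield_left_mul_inj _ _ _ _ _ qfQ a0).
Qed.

(** Raising to the power [2d + 2] clears the denominator of the exponent. *)
Lemma powR_ratio_lt_expn (R : realType) (d q n : nat) :
  ((q%:R : R) `^ ((d%:R + 2) / (2 * d%:R + 2)) < n%:R)%R ->
  q ^ d.+2 < n ^ (d.+1).*2.
Proof.
move=> qn; rewrite -(ltr_nat R) !natrX -!powR_mulrn ?ler0n //.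
have -> : (d.+2%:R = (d%:R + 2) / (2 * d%:R + 2) * (d.+1).*2%:R :> R)%R.
  rewrite -mul2n natrM -[d.+2]addn2 -[d.+1]addn1 !natrD mulrDr mulr1 mulfVK //.
  by rewrite gt_eqF // ltr_wpDl // mulr_ge0.
by rewrite powRrM; apply: gt0_ltr_powR; rewrite ?ltr0n ?nnegrE ?powR_ge0 ?ler0n.
Qed.

Local Open Scope ring_scope.

Theorem theorem1p11 (R : realType) (d : nat) (Q : finType) (zero : Q)
    (add mul : Q -> Q -> Q) (A : {set Q}) :
  (1 <= d)%N ->
  is_quasifield zero add mul ->
  (#|Q|%:R : R) `^ ((d%:R + 2) / (2 * d%:R + 2)) < #|A|%:R ->
  [set: Q] = setop add (setop add A A) (sum_of_products zero add mul d A).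
Proof.
(* Destructing [Q] makes [{set Q}] and [{set V}] below convertible. *)
case: Q zero add mul A => T [mc mn me mf]; set Q := Finite.Pack _.
move=> zero add mul A d_gt0 qfQ /(powR_ratio_lt_expn _ d) cardA.
have addC := quasifield_addC _ _ _ _ qfQ.
have [gQ _ _ _ planar] := qfQ; have [addA add0 _ _] := gQ.
have [inv [addN addrN]] := group_inverse _ _ _ gQ.
pose V : finZmodType := HB.pack Q (GRing.isZmodule.Build Q addA addC add0 addN).
apply/esym/setP => t; rewrite [RHS]inE.
have [a b x y c /eqP ab ax ay| | |u [v [f [g [uA vA fA gA ->]]]]] //:=
    @planar_sum_of_products V mul d A t.
  by have [z [_ zU]] := planar a b c ab; rewrite -(zU x) ?(zU y).
apply/imset2P; exists (add u v) (\big[add/zero]_i mul (f i) (g i)) => //.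
  exact: imset2_f.
(* The sum of elements and the sum of sets are built up in parallel, starting from [zero] in
   [[set zero]]. *)
rewrite /sum_of_products; elim/big_rec2: _ => [|i B s _ sB]; first by rewrite inE.
by apply: imset2_f => //; apply: imset2_f.
Qed.
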